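(* Let $n\ge 2$ and let $f$ be a regular polynomial automorphism of $\mathbb{C}^n$. Then there exist a compact set $V\subset\mathbb{C}^n$ with $K\subset\operatorname{int}V$ and sets $V^+,V^-\subset\mathbb{C}^n$ with $\mathbb{C}^n=V\cup V^-\cup V^+$, such that the following hold. (i) $f(V^-)\subset V^-$; (ii) $f(V^-\cup V)\subset V^-\cup V$; (iii) $f^{-1}(V^+)\subset V^+$; (iv) $f^{-1}(V^+\cup V)\subset V^+\cup V$.
   Context: Let $f=(f_1,\dots,f_n)$ be a polynomial automorphism of $\mathbb{C}^n$ (a polynomial map with polynomial inverse), $d=\deg f=\max_i\deg f_i$. View $\mathbb{C}^n\subset\mathbb{P}^n$ with hyperplane at infinity $H_0$, and let $\hat f$ be the extension of $f$ to a meromorphic map of $\mathbb{P}^n$. If $F$ is the homogeneous degree-$d$ polynomial map of $\mathbb{C}^{n+1}$ inducing $\hat f$, the indeterminacy set is $I^+=\pi(F^{-1}(0)\setminus\{0\})\subset H_0$, where $\pi:\mathbb{C}^{n+1}\setminus\{0\}\to\mathbb{P}^n$ is the canonical projection; $I^-$ is the indeterminacy set of $\widehat{f^{-1}}$ defined in the same way. $f$ is regular if $d>1$ and $I^+\cap I^-=\emptyset$. $K^{\pm}=\{p\in\mathbb{C}^n:\{f^{\pm k}(p):k\in\mathbb{N}\}\text{ is bounded}\}$ and $K=K^+\cap K^-$. *)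

(* Defs.v *)
From HB Require Import structures.
From mathcomp Require Import all_boot all_order all_algebra.
From mathcomp Require Import complex.
From mathcomp Require Import all_classical all_reals all_analysis.
From mathcomp Require mpoly.
Import -(notations) mpoly.

Set Implicit Arguments.
Unset Strict Implicit.
Unset Printing Implicit Defensive.

Import Order.TTheory GRing.Theory Num.Theory.
Import numFieldNormedType.Exports.

Local Open Scope classical_set_scope.
Local Open Scope ring_scope.

(* [complex R] packed as a [numClosedFieldType], so that the topology and the
   norm that MathComp-Analysis puts on every [numClosedFieldType] are inferred
   for it: the usual ones on the complex plane, the modulus being seen as a
   complex number. On row vectors they give the product topology and the sup
   norm. *)
Definition Cplx (R : realType) : numClosedFieldType := complex R.

Notation affine_space R n := 'rV[Cplx R]_n.

Section PolynomialMaps.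
Context {R : realType}.

Definition polymap (n : nat) := 'I_n -> mpoly n (Cplx R).

Definition polymap_eval n (f : polymap n) (p : affine_space R n) :
    affine_space R n :=
  \row_i meval (fun j => p ord0 j) (f i).

(* [msize] is the total degree plus one. *)
Definition polymap_deg n (f : polymap n) : nat := \max_(i < n) (msize (f i)).-1.

Record polyaut (n : nat) := PolyAut {
  polyaut_map : polymap n;
  polyaut_inv : polymap n;
  polyaut_mapK : cancel (polymap_eval polyaut_map) (polymap_eval polyaut_inv);
  polyaut_invK : cancel (polymap_eval polyaut_inv) (polymap_eval polyaut_map)
}.

Definition inv_aut n (f : polyaut n) : polyaut n :=
  PolyAut (@polyaut_invK n f) (@polyaut_mapK n f).

Definition aut_fun n (f : polyaut n) : affine_space R n -> affine_space R n :=
  polymap_eval (polyaut_map f).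

Definition aut_deg n (f : polyaut n) : nat := polymap_deg (polyaut_map f).

(* x_0 ^ d * p (x_1 / x_0, ..., x_n / x_0), for p of degree at most d;
   x_0 is the variable of index [ord0]. *)
Definition homogenize n (d : nat) (p : mpoly n (Cplx R)) :
    mpoly n.+1 (Cplx R) :=
  \sum_(m <- msupp p) mcoeff m p *:
    (mpolyX (Cplx R) (mnm1 ord0) ^+ (d - mdeg m) *
     \prod_(j < n) mpolyX (Cplx R) (mnm1 (lift ord0 j)) ^+ m j).

(* The homogeneous map of degree d = deg f on C ^ n.+1 that induces the
   extension of f to P ^ n; C ^ n sits in P ^ n as the chart x_0 != 0 and H_0
   is x_0 = 0. *)
Definition homog_lift n (f : polyaut n) : polymap n.+1 :=
  fun i => if unlift ord0 i is Some j
           then homogenize (aut_deg f) (polyaut_map f j)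
           else mpolyX (Cplx R) (mnm1 ord0) ^+ aut_deg f.

(* A point of P ^ n is a line through the origin of C ^ n.+1. *)
Definition proj_space (n : nat) :=
  {L : {vspace affine_space R n.+1} | (\dim L == 1)%N}.

(* I^+; [indet (inv_aut f)] is I^-. The condition [val P = <[z]>%VS] says that
   P is the image of z under the canonical projection. *)
Definition indet n (f : polyaut n) : set (proj_space n) :=
  [set P | exists z : affine_space R n.+1,
     [/\ polymap_eval (homog_lift f) z = 0, z != 0 & val P = <[z]>%VS]].

Definition regular n (f : polyaut n) : Prop :=
  (1 < aut_deg f)%N /\ indet f `&` indet (inv_aut f) = set0.

Definition Kplus n (f : polyaut n) : set (affine_space R n) :=
  [set p | bounded_set [set iter k (aut_fun f) p | k in [set: nat]]].

Definition Kminus n (f : polyaut n) : set (affine_space R n) :=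
  Kplus (inv_aut f).

Definition Kset n (f : polyaut n) : set (affine_space R n) :=
  Kplus f `&` Kminus f.

End PolynomialMaps.

Arguments polyaut : clear implicits.

(* Main.v *)
Require Import Defs.
From mathcomp Require Import all_boot all_order all_algebra.
From mathcomp Require Import all_classical all_reals all_analysis.
From mathcomp Require Import complex ring.
From mathcomp Require mpoly.
Import -(notations) mpoly.
Import Order.TTheory GRing.Theory Num.Theory.
Import numFieldNormedType.Exports.
Set Implicit Arguments.
Unset Strict Implicit.
Unset Printing Implicit Defensive.
Local Open Scope classical_set_scope.
Local Open Scope ring_scope.

(** Write g for the inverse of f. Everything follows from one estimate
    ([regular_expansion]): there is r > 0 such that every p with |p| > r
    satisfies |f p| >= 2 |p| or |g p| >= 2 |p|.

    The estimate is where regularity enters. Let F and G be the homogeneous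
    lifts of f and g, of degrees d and d'. A common zero z != 0 of F and G would
    span a line lying in both indeterminacy sets, so by compactness |F| + |G|
    has a lower bound c > 0 on the unit sphere of C ^ n.+1
    ([regular_lower_bound]). When |p| = x >= 1, the vector (1, p) / x lies on
    that sphere, and by homogeneity F sends it to (1, f p) / x ^ d
    ([homog_lift_chart]). If |f p| and |g p| were both smaller than 2 x, then,
    as d and d' are at least 2, both |F| and |G| would be at most
    2 x / x ^ 2 = 2 / x, which is impossible once x > 4 / c.

    The definition of regularity only gives d >= 2. That d' >= 2 as well
    ([aut_deg_inv_gt1]) comes from the fact that an injective affine map of C ^ n
    has an affine inverse; to pass from the function f to the degree of its
    defining polynomials one needs that a polynomial over an infinite field is
    determined by its values ([meval_eq0]).

    Given the estimate, the filtration is a cut of the space into three disjoint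
    pieces: V is a closed ball of radius at least r, and a point p outside V
    goes to V^- if |f p| >= 2 |p| and to V^+ otherwise, in which case
    |g p| >= 2 |p|. If q = f p lies outside V and |q| is more than |p| / 2, then
    g does not double the norm of q, so f does: q is in V^-. This covers all p
    in V or V^- ([expands_next]), and the case of V^+ is symmetric
    ([expands_filtration]). Finally a point outside the ball of radius r keeps
    being expanded by f or by g, so that one of its half-orbits is unbounded and
    the point is not in K ([Kset_rnorm_le]); taking a radius larger than r for V
    puts K in the interior. *)

(** * Polynomials as functions *)

Section PolynomialIdentity.
Variable K : numFieldType.

Lemma poly_eval0 (p : {poly K}) : (forall x, p.[x] = 0) -> p = 0.
Proof.
move=> p0; apply/eqP; apply: contraT => pN0.
have := max_poly_roots pN0 (rs := [seq i%:R | i <- iota 0 (size p)]).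
rewrite size_map size_iota ltnn => -> //.
- by apply/allP => x _; apply/rootP.
- by rewrite map_inj_uniq ?iota_uniq// => i j /eqP; rewrite eqr_nat => /eqP.
Qed.

(** [muni] views a polynomial in n.+1 variables as a polynomial in the last
    one; together the coefficients of its coefficients are all those of p, so
    that [muni p = 0] forces [p = 0]. *)
Lemma mcoeff_muni n (p : mpoly n.+1 K) (m : multinom n.+1) :
  mcoeff (Multinom [tuple m (widen_ord (leqnSn n) i) | i < n])
    (muni p)`_(m ord_max) = mcoeff m p.
Proof.
rewrite muniE coef_sum raddf_sum /=.
have E m' : mcoeff (Multinom [tuple m (widen_ord (leqnSn n) i) | i < n])
    (mcoeff m' p *: mpolyX K (Multinom [tuple m' (widen_ord (leqnSn n) i) | i < n])
       *: 'X^(m' ord_max))`_(m ord_max) = if m' == m then mcoeff m p else 0.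
  rewrite coefZ coefXn.
  have [->|m'm] := eqVneq m' m; first by rewrite eqxx mulr1 mcoeffZ mcoeffX eqxx mulr1.
  have [mm'|] := eqVneq (m ord_max) (m' ord_max); last by rewrite mulr0 mcoeff0.
  rewrite mulr1 mcoeffZ mcoeffX; case: eqP => [EE|]; last by rewrite mulr0.
  case/eqP: m'm; apply/mnmP => i.
  case: (unliftP ord_max i) => [j ->|->//].
  have -> : lift ord_max j = widen_ord (leqnSn n) j.
    by apply/val_inj; rewrite /= /bump leqNgt ltn_ord.
  by have /mnmP/(_ j) := EE; rewrite !mnmE.
rewrite (eq_bigr _ (fun m' _ => E m')).
case: (boolP (m \in msupp p)) => [mp|mp].
  by rewrite (bigD1_seq m) ?msupp_uniq//= eqxx big1 ?addr0// => m' /negbTE->.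
rewrite big_seq big1 ?(memN_msupp_eq0 mp)// => m' m'p.
by case: eqP.
Qed.

Lemma meval_muni n (p : mpoly n.+1 K) (v : 'I_n.+1 -> K) :
  meval v p =
  (map_poly (meval (fun i => v (widen_ord (leqnSn n) i))) (muni p)).[v ord_max].
Proof.
rewrite muniE raddf_sum horner_sum mevalE; apply: eq_bigr => m _ /=.
rewrite map_polyZ map_polyXn hornerZ hornerXn /= mevalZ mevalX -mulrA.
congr (_ * _); rewrite big_ord_recr /=; congr (_ * _).
by apply: eq_bigr => i _; rewrite mnmE.
Qed.

(** By induction on the number of variables: with the first n of them fixed,
    [muni p] specializes to a univariate polynomial vanishing at every scalar,
    hence its coefficients vanish at every point of K ^ n. *)
Lemma meval_eq0 n (p : mpoly n K) : (forall v, meval v p = 0) -> p = 0.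
Proof.
elim: n p => [|n IHn] p p0.
  apply/mpolyP => m; rewrite mcoeff0.
  have -> : m = mnm0 by apply/mnmP => -[].
  have := p0 (fun=> 0).
  have -> : p = mpolyC 0 (mcoeff mnm0 p).
    apply/mpolyP => k; have -> : k = mnm0 by apply/mnmP => -[].
    by rewrite mcoeffC eqxx mulr1.
  by rewrite mevalC mcoeffC eqxx mulr1.
apply/mpolyP => m; rewrite mcoeff0 -mcoeff_muni.
suff -> : (muni p)`_(m ord_max) = 0 by rewrite mcoeff0.
apply: IHn => v.
suff /polyP/(_ (m ord_max)) : map_poly (meval v) (muni p) = 0.
  by rewrite coef_map coef0.
apply: poly_eval0 => x.
pose w i := if unlift ord_max i is Some j then v j else x.
rewrite -[RHS](p0 w) meval_muni /w unlift_none; congr (_.[_]).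
apply: eq_map_poly => q; apply: meval_eq => i.
have -> : widen_ord (leqnSn n) i = lift ord_max i.
  by apply/val_inj; rewrite /= /bump leqNgt ltn_ord.
by rewrite liftK.
Qed.
End PolynomialIdentity.

(** Having degree at most 1 becomes a property of the function alone, which is
    what allows one to compute the degree of an automorphism known only as the
    inverse of another. *)
Lemma msize_affineP (K : numFieldType) n (p : mpoly n K) :
  (msize p <= 2)%N <->
  exists c a, forall v, meval v p = c + \sum_i v i * a i.
Proof.
pose aff c (a : 'I_n -> K) := mpolyC n c + \sum_i a i *: mpolyX K (mnm1 i).
have meval_aff c a v : meval v (aff c a) = c + \sum_i v i * a i.
  rewrite mevalD mevalC raddf_sum /=; congr (_ + _); apply: eq_bigr => i _.
  by rewrite mevalZ mevalXU mulrC.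
have mcoeff_aff c a m : mcoeff m (aff c a) =
    c * (m == mnm0)%:R + \sum_i a i * (mnm1 i == m)%:R.
  rewrite mcoeffD mcoeffC raddf_sum /=; congr (_ + _); apply: eq_bigr => i _.
  by rewrite mcoeffZ mcoeffX.
split=> [p2|[c [a pE]]].
  exists (mcoeff mnm0 p), (fun i => mcoeff (mnm1 i) p) => v.
  rewrite -meval_aff; congr meval; apply/mpolyP => m; rewrite mcoeff_aff.
  have [m0|mN0] := eqVneq m mnm0.
    rewrite mulr1 big1 ?addr0 ?m0// => i _.
    by rewrite -mdeg_eq0 in m0 *; rewrite mdeg1 mulr0.
  rewrite mulr0 add0r.
  have [/mdeg1P[i /eqP ->]|m1] := boolP (mdeg m == 1%N).
    rewrite (bigD1 i)//= eqxx mulr1 big1 ?addr0// => j ji.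
    have [/mnmP/(_ j)|] := eqVneq (mnm1 j) (mnm1 i); last by rewrite mulr0.
    by rewrite !mnm1E eqxx eq_sym (negbTE ji).
  rewrite big1 => [|i _]; last first.
    by case: (mnm1 i =P m) m1 => [<-|_ _]; rewrite ?mdeg1 ?mulr0.
  apply/eqP; rewrite mcoeff_eq0; apply: msize_mdeg_ge; apply: leq_trans p2 _.
  by rewrite ltn_neqAle eq_sym m1 lt0n mdeg_eq0.
have -> : p = aff c a.
  apply/eqP; rewrite -subr_eq0; apply/eqP/meval_eq0 => v.
  by rewrite mevalB pE meval_aff subrr.
apply: leq_trans (msizeD_le _ _) _; rewrite geq_max msizeC.
rewrite (leq_trans (leq_b1 _))//=; apply: leq_trans (msize_sum _ _ _) _.
apply/bigmax_leqP => i _; apply: leq_trans (msizeZ_le _ _) _.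
by rewrite msizeX mdeg1.
Qed.

Section Degree.
Variables (R : realType) (n : nat).

Lemma aut_deg_affineP (f : polyaut R n) :
  (aut_deg f <= 1)%N <->
  exists (A : 'M[Cplx R]_n) b, forall p, aut_fun f p = p *m A + b.
Proof.
split=> [/bigmax_leqP f1|[A [b fE]]]; last first.
  apply/bigmax_leqP => i _; rewrite -subn1 leq_subLR.
  apply/msize_affineP; exists (b ord0 i), (A ^~ i) => v.
  have := congr1 (fun M : 'rV_n => M ord0 i) (fE (\row_j v j)).
  rewrite !mxE addrC => E.
  rewrite (eq_bigr (fun j => (\row_j v j) ord0 j * A j i)).
    by rewrite -E; apply: meval_eq => j; rewrite mxE.
  by move=> j _; rewrite mxE.
have H i : exists ca : Cplx R * ('I_n -> Cplx R),
    forall v, meval v (polyaut_map f i) = ca.1 + \sum_j v j * ca.2 j.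
  have /msize_affineP[c [a E]] : (msize (polyaut_map f i) <= 2)%N.
    by have := f1 i isT; rewrite -subn1 leq_subLR.
  by exists (c, a).
have [ca caE] := choice H.
exists (\matrix_(j, i) (ca i).2 j), (\row_i (ca i).1) => p.
apply/rowP => i; rewrite !mxE caE addrC; congr (_ + _).
by apply: eq_bigr => j _; rewrite !mxE.
Qed.

(** Contrapositive: the inverse [p |-> p *m A + b] of f is injective, so A is
    invertible and f itself is affine. *)
Lemma aut_deg_inv_gt1 (f : polyaut R n) :
  (1 < aut_deg f)%N -> (1 < aut_deg (inv_aut f))%N.
Proof.
rewrite !ltnNge; apply: contra => /aut_deg_affineP[A [b gE]].
have fK : cancel (aut_fun f) (aut_fun (inv_aut f)) by exact: polyaut_mapK.
have gK : cancel (aut_fun (inv_aut f)) (aut_fun f) by exact: polyaut_invK.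
have Aunit : A \in unitmx.
  rewrite -row_free_unit; apply: inj_row_free => u uA.
  by apply: (can_inj gK); rewrite !gE uA mul0mx.
apply/aut_deg_affineP; exists (invmx A), (- b *m invmx A) => p.
by rewrite -mulmxDl -{2}(fK p) gE addrK mulmxK.
Qed.
End Degree.

(** * The norm and the topology of complex affine space *)

Section CplxTopology.
Variable R : realType.
Local Notation rc := (real_complex R).
Local Notation Re := (@complex.Re R).

Lemma normC_real (x : R) : `|rc x : Cplx R| = rc `|x|.
Proof. by rewrite normc_def /= expr0n/= addr0 sqrtr_sqr. Qed.

Lemma normCi : `|'i%C : Cplx R| = 1.
Proof. by rewrite normc_def /= expr0n /= expr1n add0r sqrtr1. Qed.

Lemma gt0_real_complex (e : Cplx R) : 0 < e -> e = rc (Re e) /\ 0 < Re e.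
Proof.
rewrite ltcE => /andP[/eqP ei er]; split => //.
by apply/eqP; rewrite eq_complex eqxx/= ei.
Qed.

Lemma Re_continuous : continuous (Re : Cplx R -> R).
Proof.
move=> x A /nbhs_ballP[e e0 sA]; apply/nbhs_ballP; exists (rc e).
  by rewrite /= ltcR.
move=> y xy; apply: sA; rewrite /ball /= -raddfB /= -ltcR.
exact: le_lt_trans (normc_ge_Re _) xy.
Qed.

Lemma complex_continuous : continuous (fun x : R * R => (x.1 +i* x.2)%C : Cplx R).
Proof.
move=> [a b] A /nbhs_ballP[e /= /gt0_real_complex[-> e0] sA].
apply/nbhs_ballP; exists (Re e / 2); first by rewrite /= divr_gt0.
move=> [c d] [/= ac bd]; apply: sA; rewrite /ball /=.
rewrite [X in `|X|](_ : _ = rc (a - c) + 'i%C * rc (b - d)); last first.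
  by rewrite [LHS]complexE.
apply: le_lt_trans (ler_normD _ _) _; rewrite normrM !normC_real.
by rewrite normCi mul1r -rmorphD ltcR (splitr (Re e)) ltrD.
Qed.

(** The norm of a vector space over [Cplx R] is itself a complex number; the
    order on the complex numbers being partial, estimates and compactness
    arguments are carried out with its real part, which carries the same
    information. *)
Definition rnorm (V : normedModType (Cplx R)) (v : V) : R :=
  Re (`|v| : Cplx R).

Lemma rnormE (V : normedModType (Cplx R)) (v : V) : `|v| = rc (rnorm v).
Proof.
have := normr_ge0 v; rewrite lecE => /andP[/eqP vi _].
by apply/eqP; rewrite eq_complex /= eqxx vi eqxx.
Qed.

Lemma rnorm_continuous (V : normedModType (Cplx R)) :
  continuous (@rnorm V).
Proof.
move=> v; apply: (@continuous_comp _ _ _ (@Num.norm _ V) (Re : Cplx R -> R)).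
  exact: norm_continuous.
exact: Re_continuous.
Qed.

Lemma rnorm_ge0 (V : normedModType (Cplx R)) (v : V) : 0 <= rnorm v.
Proof. by rewrite -lecR -rnormE; exact: normr_ge0. Qed.

Lemma rnorm_eq0 (V : normedModType (Cplx R)) (v : V) : (rnorm v == 0) = (v == 0).
Proof. by rewrite -(normr_eq0 v) rnormE eq_complex /= eqxx andbT. Qed.

Lemma rnorm0 (V : normedModType (Cplx R)) : rnorm (0 : V) = 0.
Proof. by apply/eqP; rewrite rnorm_eq0. Qed.

Lemma rnormZ (V : normedModType (Cplx R)) (a : R) (v : V) :
  rnorm (rc a *: v) = `|a| * rnorm v.
Proof. by apply: complexI; rewrite -rnormE normrZ normC_real rnormE -rmorphM. Qed.

Lemma closed_rnorm_le (V : normedModType (Cplx R)) (r : R) :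
  closed [set v : V | rnorm v <= r].
Proof.
apply: (@preimage_closed _ _ (@rnorm V) [set x | x <= r]); last exact: closed_le.
by move=> v _; exact: (@rnorm_continuous V v).
Qed.

(** The disc is a closed subset of the square [-r, r] ^ 2, the image of a
    compact set under (a, b) |-> a + i b. *)
Lemma disc_compact (r : R) : compact [set z : Cplx R | rnorm z <= r].
Proof.
pose square := (fun x : R * R => (x.1 +i* x.2)%C : Cplx R) @`
  (`[- r, r] `*` `[- r, r]).
apply: (@subclosed_compact _ _ square).
- exact: closed_rnorm_le.
- apply: continuous_compact; last by apply: compact_setX; exact: segment_compact.
  exact/continuous_subspaceT/complex_continuous.
- move=> [a b] /= zr; exists (a, b) => //=.
  split; rewrite /= in_itv /= -ler_norml -lecR;
    apply: (@le_trans _ _ (rc (rnorm ((a +i* b)%C : Cplx R))));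
    rewrite ?[_ <= rc r]lecR//; rewrite -rnormE.
    exact: (normc_ge_Re (a +i* b)%C).
  (* Up to sign, the imaginary part of z is the real part of i z. *)
  have := normc_ge_Re ('i%C * (a +i* b)%C).
  rewrite normrM ['i%C * _]mulrC ReiNIm normrN /=.
  by rewrite normCi mul1r.
Qed.

Lemma rnorm_leP n (v : affine_space R n) (r : R) : 0 <= r ->
  rnorm v <= r <-> forall i, rnorm (v ord0 i) <= r.
Proof.
move=> r0; split=> [vr i|vr].
  apply: le_trans vr; rewrite -lecR -!rnormE.
  rewrite [leRHS]/(Num.norm _) /= mx_normE -[leLHS]nngE num_le.
  exact: (le_bigmax _ _ (ord0, i)).
have [->|vN0] := eqVneq v 0.
  by rewrite rnorm0.
have /mx_norm_neq0[[i j]] /= : mx_norm v != 0.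
  by rewrite -[mx_norm v]/(`|v|) normr_eq0.
rewrite ord1 => vE; rewrite -lecR -rnormE [leLHS]vE rnormE lecR; exact: vr.
Qed.

Lemma ball_compact n (r : R) : compact [set v : affine_space R n | rnorm v <= r].
Proof.
have [r0|r0] := leP 0 r; last first.
  rewrite [X in compact X](_ : _ = set0); first exact: compact0.
  apply/seteqP; split => // v /= vr.
  by have := le_lt_trans (le_trans (rnorm_ge0 v) vr) r0; rewrite ltxx.
have -> : [set v : affine_space R n | rnorm v <= r] =
    [set v : affine_space R n | forall i, rnorm (v ord0 i) <= r].
  by apply/seteqP; split => v /= /(rnorm_leP _ r0).
apply: (@rV_compact (Cplx R) n (fun=> [set z | rnorm z <= r])) => _.
exact: disc_compact.
Qed.

End CplxTopology.

Lemma nbhs_rnorm_lt (R : realType) (V : normedModType (Cplx R)) (v : V) (r : R) :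
  rnorm v < r -> nbhs v [set w | rnorm w < r].
Proof.
move=> vr; apply: (@rnorm_continuous R V v [set x | x < r]).
exact: open_nbhs_nbhs (conj (@open_lt R r) vr).
Qed.

Lemma bounded_rnorm (R : realType) (V : normedModType (Cplx R)) (A : set V) :
  bounded_set A -> exists M : R, forall v, A v -> rnorm v <= M.
Proof.
move=> [M [Mreal MA]]; exists (complex.Re M + 1) => v Av.
have ME : M = real_complex R (complex.Re M) by rewrite RRe_real.
rewrite -lecR -rnormE; apply: MA => //.
by rewrite {1}ME ltcR ltrDl.
Qed.

Lemma rV_continuous (K : numFieldType) (T : topologicalType) n (f : T -> 'rV[K]_n) :
  (forall i, continuous (fun x => f x ord0 i)) -> continuous f.
Proof.
move=> fc x A /nbhs_ballP[e /= e0 sA].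
have H : \forall y \near x, forall i, ball (f x ord0 i) e (f y ord0 i).
  by apply: filter_forall => i; apply: fc; exact: nbhsx_ballx.
by apply: filterS H => y xy; apply: sA; split => // i j; rewrite ord1; exact: xy.
Qed.

Lemma meval_continuous (K : numFieldType) (T : topologicalType) n
    (x : 'I_n -> T -> K) (q : mpoly n K) :
  (forall j, continuous (x j)) -> continuous (fun t => meval (x ^~ t) q).
Proof.
move=> xC; under eq_fun do rewrite mevalE.
apply: continuous_big => [|m _ t]; first exact: add_continuous.
apply: cvgMl_tmp; move: t.
apply: continuous_big => [|j _]; first exact: mul_continuous.
elim: (m j) => [|k IHk]; first by move=> t; exact: cvg_cst.
under eq_fun do rewrite exprS.
by move=> t; apply: cvgM; [exact: xC|exact: IHk].
Qed.

Lemma polymap_continuous (R : realType) n (f : @polymap R n) : continuous (polymap_eval f).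
Proof.
apply: rV_continuous => i.
under eq_fun do rewrite mxE.
by apply: meval_continuous => j; exact: coord_continuous.
Qed.

Lemma rnorm_comp_continuous (R : realType) (V : normedModType (Cplx R))
    (T : topologicalType) (g : T -> V) :
  continuous g -> continuous (fun t => rnorm (g t)).
Proof.
by move=> gC t; apply: continuous_comp; [exact: gC|exact: rnorm_continuous].
Qed.

Lemma continuous_sum2 (R : realType) (T : topologicalType) (g h : T -> R) :
  continuous g -> continuous h -> continuous (fun t => g t + h t).
Proof. by move=> gC hC t; apply: cvgD; [exact: gC|exact: hC]. Qed.

(** * The homogeneous lift and the expansion far from the origin *)

Section Chart.
Variables (R : realType) (n : nat).
Implicit Types (f : polyaut R n) (p : affine_space R n) (z : affine_space R n.+1).
Local Notation rc := (real_complex R).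

(** The point (1, p) of C ^ n.+1 over p, in the chart x_0 = 1. *)
Definition chart p : affine_space R n.+1 :=
  \row_i if unlift ord0 i is Some j then p ord0 j else 1.

Lemma meval_homogenize d (q : mpoly n (Cplx R)) (s : Cplx R) p :
  ((msize q).-1 <= d)%N ->
  meval (fun i => (s *: chart p) ord0 i) (homogenize d q) =
  s ^+ d * meval (fun j => p ord0 j) q.
Proof.
move=> qd; rewrite /homogenize raddf_sum mevalE mulr_sumr /=.
rewrite big_seq [RHS]big_seq; apply: eq_bigr => m mq.
have md : (mdeg m <= d)%N.
  by rewrite (leq_trans _ qd)// -ltnS (leq_trans (msize_mdeg_lt mq))// leqSpred.
rewrite mevalZ mevalM rmorphXn rmorph_prod /= mevalXU !mxE unlift_none mulr1.
rewrite [RHS]mulrCA; congr (_ * _).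
rewrite (eq_bigr (fun j => s ^+ m j * p ord0 j ^+ m j)); last first.
  by move=> j _; rewrite rmorphXn /= mevalXU !mxE liftK exprMn.
by rewrite big_split /= prodrXr -mdegE mulrA -exprD subnK.
Qed.

(** This is the homogeneity of the lift, in the only form in which it relates
    the behaviour of f far away to that of the lift on the unit sphere. *)
Lemma homog_lift_chart f (s : Cplx R) p :
  polymap_eval (homog_lift f) (s *: chart p) =
  s ^+ aut_deg f *: chart (aut_fun f p).
Proof.
apply/rowP => i; rewrite !mxE /homog_lift.
case: unliftP => [j _|_]; last first.
  by rewrite rmorphXn /= mevalXU !mxE unlift_none !mulr1.
rewrite meval_homogenize; first by rewrite /aut_fun mxE.
exact: (bigop.bigmax_sup j).
Qed.

Lemma rnorm_chart p : rnorm (chart p) = Num.max 1 (rnorm p).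
Proof.
have rnorm1 : rnorm (1 : Cplx R) = 1.
  by apply: complexI; rewrite -rnormE normr1.
have chartP r : 0 <= r -> rnorm (chart p) <= r <-> 1 <= r /\ rnorm p <= r.
  move=> r0; split=> [/(rnorm_leP _ r0) H|[r1 /(rnorm_leP _ r0) H]].
    split; first by have := H ord0; rewrite mxE unlift_none rnorm1.
    by apply/(rnorm_leP _ r0) => j; have := H (lift ord0 j); rewrite mxE liftK.
  apply/(rnorm_leP _ r0) => i; rewrite mxE.
  by case: unliftP => [j _|_]; [exact: H|rewrite rnorm1].
apply/eqP; rewrite eq_le ge_max; apply/andP; split.
  by apply/chartP; rewrite ?le_max ?lexx ?orbT// ler01.
by apply/andP/chartP; rewrite ?rnorm_ge0.
Qed.

Lemma sphere_compact : compact [set z : affine_space R n.+1 | rnorm z = 1].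
Proof.
apply: (@subclosed_compact _ _ [set z | rnorm z <= 1]).
- have -> : [set z : affine_space R n.+1 | rnorm z = 1] =
    @rnorm R _ @^-1` [set 1] by [].
  apply: preimage_closed; last exact: closed_eq.
  by move=> z _; exact: rnorm_continuous.
- exact: ball_compact.
- by move=> z /= ->.
Qed.

(** The line spanned by a common zero would be a point of both indeterminacy
    sets. *)
Lemma regular_no_zero f z : regular f -> z != 0 ->
  polymap_eval (homog_lift f) z = 0 ->
  polymap_eval (homog_lift (inv_aut f)) z = 0 -> False.
Proof.
move=> [_ fI] zN0 Fz Gz.
have dimz : (\dim <[z]>%VS == 1)%N by rewrite dim_vline zN0.
suff : (indet f `&` indet (inv_aut f)) (exist _ <[z]>%VS dimz : proj_space n).
  by rewrite fI.
by split; exists z.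
Qed.

Lemma regular_lower_bound f : regular f ->
  exists2 c : R, 0 < c & forall z, rnorm z = 1 ->
    c <= rnorm (polymap_eval (homog_lift f) z) +
         rnorm (polymap_eval (homog_lift (inv_aut f)) z).
Proof.
move=> fr.
pose H z := rnorm (polymap_eval (homog_lift f) z) +
  rnorm (polymap_eval (homog_lift (inv_aut f)) z).
have HC : continuous H.
  have FC (g : polymap n.+1) : continuous (fun z => rnorm (polymap_eval g z)).
    exact: (rnorm_comp_continuous (@polymap_continuous _ _ g)).
  exact: continuous_sum2 (FC _) (FC _).
have S0 : [set z : affine_space R n.+1 | rnorm z = 1] !=set0.
  exists (chart 0) => /=; rewrite rnorm_chart.
  by rewrite rnorm0 max_l.
have [w] := compact_EVT_min S0 sphere_compact (continuous_subspaceT HC).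
rewrite inE /= => w1 Hmin; exists (H w); last first.
  by move=> z z1; apply: Hmin; rewrite inE.
rewrite lt_neqAle addr_ge0 ?rnorm_ge0// andbT eq_sym.
rewrite paddr_eq0 ?rnorm_ge0// !rnorm_eq0.
apply/negP => /andP[/eqP Fw /eqP Gw].
apply: (regular_no_zero fr _ Fw Gw).
by rewrite -rnorm_eq0 w1 oner_eq0.
Qed.

(** The lower bound is applied to (1, p) / |p|. The radius 4 / c is where two
    contributions of at most 2 / |p| each can no longer add up to c; the radius
    1 makes (1, p) and p have the same norm. *)
Lemma regular_expansion f : regular f ->
  exists2 r : R, 0 < r & forall p, r < rnorm p ->
    2 * rnorm p <= rnorm (aut_fun f p) \/
    2 * rnorm p <= rnorm (aut_fun (inv_aut f) p).
Proof.
move=> fr; have [c c0 cP] := regular_lower_bound fr.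
exists (Num.max 1 (4 / c)) => [|p]; first by rewrite lt_max ltr01.
rewrite gt_max => /andP[]; set x := rnorm p => x1 xc.
have x0 : 0 < x by apply: lt_trans x1.
have [|fx] := leP (2 * x) (rnorm (aut_fun f p)); first by left.
have [|gx] := leP (2 * x) (rnorm (aut_fun (inv_aut f) p)); first by right.
have xV : `|x^-1| = x^-1 by rewrite ger0_norm// invr_ge0 ltW.
have lift_le g : (1 < aut_deg g)%N -> rnorm (aut_fun g p) < 2 * x ->
    rnorm (polymap_eval (homog_lift g) (rc x^-1 *: chart p)) <= 2 * x^-1.
  move=> g1 gx2; rewrite homog_lift_chart -rmorphXn rnormZ normrX xV rnorm_chart.
  apply: (@le_trans _ _ (x^-1 ^+ 2 * (2 * x))).
    apply: ler_pM.
    - by rewrite exprn_ge0// invr_ge0 ltW.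
    - by rewrite le_max ler01.
    - by rewrite ler_wiXn2l// ?invr_ge0 ?(ltW x0)// invf_le1 ?ltW.
    - rewrite ge_max (ltW gx2) andbT (le_trans (ltW x1))//.
      by rewrite ler_peMl ?(ltW x0)// ler1n.
  by rewrite (_ : x^-1 ^+ 2 * (2 * x) = 2 * x^-1)//; field; rewrite gt_eqF.
have := cP (rc x^-1 *: chart p).
rewrite rnormZ xV rnorm_chart max_r ?(ltW x1)// mulVf ?gt_eqF// => /(_ erefl).
move=> /le_trans/(_ (lerD (lift_le f fr.1 fx)
  (lift_le _ (aut_deg_inv_gt1 fr.1) gx))) cx.
have {cx} : c <= 4 * x^-1.
  by rewrite (_ : 4 * x^-1 = 2 * x^-1 + 2 * x^-1) //; ring.
rewrite ler_pdivlMr// => cx4; move: xc.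
by rewrite ltr_pdivrMr// mulrC ltNge cx4.
Qed.
End Chart.

(** * Filtrations for a map that expands forwards or backwards *)

Section Expansion.
Variables (R : archiRealFieldType) (T : Type) (N : T -> R).
Implicit Types (F G : T -> T) (p : T) (r : R).

(** The filtration depends on F and G only through the sizes N of the points of
    their orbits, whence the abstract setting. *)
Definition expands_beyond r F G := forall p, r < N p ->
  2 * N p <= N (F p) \/ 2 * N p <= N (G p).

Lemma expands_beyondC r F G : expands_beyond r F G -> expands_beyond r G F.
Proof. by move=> FG p /FG[]; [right|left]. Qed.

Lemma lt_double r x : 0 < r -> r < x -> x < 2 * x.
Proof. by move=> r0 rx; rewrite ltr_pMl ?ltr1n// (lt_trans r0). Qed.

(** At the point F p the map G leads back to p, so when p is not much larger
    than F p the expansion at F p has to be due to F. *)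
Lemma expands_next r F G p : cancel F G -> expands_beyond r F G ->
  r < N (F p) -> N p < 2 * N (F p) -> 2 * N (F p) <= N (F (F p)).
Proof.
by move=> FK FG rF pF; have [//|] := FG _ rF; rewrite FK leNgt pF.
Qed.

Lemma expands_keep r F G p : 0 < r -> cancel F G -> expands_beyond r F G ->
  r < N p -> 2 * N p <= N (F p) ->
  r < N (F p) /\ 2 * N (F p) <= N (F (F p)).
Proof.
move=> r0 FK FG rp pF; have p_lt := lt_le_trans (lt_double r0 rp) pF.
have rF := lt_trans rp p_lt; split; first exact: rF.
exact: (expands_next FK FG rF (lt_trans p_lt (lt_double r0 rF))).
Qed.

(** Once F doubles the size of p it keeps doubling it, by [expands_keep]. *)
Lemma expands_unbounded r F G p : 0 < r -> cancel F G ->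
  expands_beyond r F G -> r < N p -> 2 * N p <= N (F p) ->
  forall M, exists k, M < N (iter k F p).
Proof.
move=> r0 FK FG rp pF M.
have orbit k : [/\ 2 ^+ k * N p <= N (iter k F p), r < N (iter k F p) &
    2 * N (iter k F p) <= N (F (iter k F p))].
  elim: k => [|k [qk rq qF]] /=; first by rewrite mul1r.
  have [rFq qFF] := expands_keep r0 FK FG rq qF.
  by split=> //; apply: le_trans qF; rewrite exprS -mulrA ler_pM2l.
have p0 : 0 < N p by apply: lt_trans rp.
exists (Num.bound `|M / N p|); have [qk _ _] := orbit (Num.bound `|M / N p|).
apply: lt_le_trans qk; rewrite -ltr_pdivrMr//.
apply: le_lt_trans (ler_norm _) _.
apply: lt_trans (archi_boundP (normr_ge0 _)) _.
by rewrite -natrX ltr_nat; exact: ltn_expl.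
Qed.

(** Vp is cut out by F, but the expansion hypothesis makes G double the size of
    its points, so that G keeps Vp for the same reason as F keeps Vm. *)
Lemma expands_filtration r F G : 0 < r -> cancel F G -> cancel G F ->
  expands_beyond r F G ->
  let V := [set p | N p <= r] in
  let Vm := [set p | r < N p /\ 2 * N p <= N (F p)] in
  let Vp := [set p | r < N p /\ N (F p) < 2 * N p] in
  [/\ F @` Vm `<=` Vm, F @` (Vm `|` V) `<=` Vm `|` V,
      G @` Vp `<=` Vp & G @` (Vp `|` V) `<=` Vp `|` V].
Proof.
move=> r0 FK GK FG V Vm Vp.
have F_Vm p : Vm p -> Vm (F p).
  by move=> [rp pF]; exact: (expands_keep r0 FK FG).
have F_V p : V p -> (Vm `|` V) (F p).
  move=> pr; have [|rF] := leP (N (F p)) r; first by right.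
  left; split; first exact: rF.
  apply: (expands_next FK FG rF).
  exact: le_lt_trans pr (lt_trans rF (lt_double r0 rF)).
have G_Vp p : Vp p -> Vp (G p).
  move=> [rp pF]; have [|pG] := FG _ rp; first by rewrite leNgt pF.
  have [rG _] := expands_keep r0 GK (expands_beyondC FG) rp pG.
  split; first exact: rG.
  rewrite GK; apply: lt_le_trans (lt_double r0 rp) _.
  exact: le_trans pG (ltW (lt_double r0 rG)).
have G_V p : V p -> (Vp `|` V) (G p).
  move=> pr; have [|rG] := leP (N (G p)) r; first by right.
  left; split; first exact: rG.
  by rewrite GK; exact: le_lt_trans pr (lt_trans rG (lt_double r0 rG)).
split=> _ [p pV <-].
- exact: F_Vm.
- by case: pV => [/F_Vm|/F_V//]; left.
- exact: G_Vp.
- by case: pV => [/G_Vp|/G_V//]; left.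
Qed.
End Expansion.

Lemma expands_Kplus (R : realType) n (f : polyaut R n) r p : 0 < r ->
  expands_beyond (@rnorm R _) r (aut_fun f) (aut_fun (inv_aut f)) ->
  r < rnorm p -> 2 * rnorm p <= rnorm (aut_fun f p) -> ~ Kplus f p.
Proof.
move=> r0 fr rp pf /bounded_rnorm[M MK].
have [k] := expands_unbounded r0 (@polyaut_mapK _ _ f) fr rp pf M.
by rewrite ltNge MK//; exists k.
Qed.

Lemma Kset_rnorm_le (R : realType) n (f : polyaut R n) r p : 0 < r ->
  expands_beyond (@rnorm R _) r (aut_fun f) (aut_fun (inv_aut f)) ->
  Kset f p -> rnorm p <= r.
Proof.
move=> r0 fr [Kp Km]; rewrite leNgt; apply/negP => rp.
case: (fr _ rp) => pf; first exact: (expands_Kplus r0 fr rp pf Kp).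
exact: (@expands_Kplus _ _ (inv_aut f) _ _ r0 (expands_beyondC fr) rp pf Km).
Qed.

Theorem proposition3p1 (R : realType) (n : nat) (n_ge2 : (2 <= n)%N)
    (f : polyaut R n) (f_regular : regular f) :
  exists V Vplus Vminus : set (affine_space R n),
    [/\ compact V,
        Kset f `<=` interior V,
        [set: affine_space R n] = V `|` Vminus `|` Vplus &
        [/\ aut_fun f @` Vminus `<=` Vminus,
            aut_fun f @` (Vminus `|` V) `<=` Vminus `|` V,
            aut_fun (inv_aut f) @` Vplus `<=` Vplus &
            aut_fun (inv_aut f) @` (Vplus `|` V) `<=` Vplus `|` V]].
Proof.
have [r r0 fr] := regular_expansion f_regular.
(* K lies in the closed ball of radius r; the larger radius r + 1 leaves room
   for the interior. *)
have r_lt : r < r + 1 by rewrite ltrDl.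
have fr1 : expands_beyond (@rnorm R _) (r + 1) (aut_fun f) (aut_fun (inv_aut f))
  by move=> p /(lt_trans r_lt)/fr.
exists [set p | rnorm p <= r + 1],
  [set p | r + 1 < rnorm p /\ rnorm (aut_fun f p) < 2 * rnorm p],
  [set p | r + 1 < rnorm p /\ 2 * rnorm p <= rnorm (aut_fun f p)].
split.
- exact: ball_compact.
- move=> p /(Kset_rnorm_le r0 fr) pr.
  apply: filterS (nbhs_rnorm_lt (le_lt_trans pr r_lt)) => q /=.
  exact: ltW.
- apply/esym; rewrite -subTset => p _ /=.
  have [|rp] := leP (rnorm p) (r + 1); first by left; left.
  have [|] := leP (2 * rnorm p) (rnorm (aut_fun f p)); first by left; right.
  by right.
- exact: (expands_filtration (lt_trans r0 r_lt) (@polyaut_mapK _ _ f)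
    (@polyaut_invK _ _ f) fr1).
Qed.
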